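(* Let $n\ge4$. The nonempty (and hence zero-dimensional) quiver varieties $\mathcal M_{D_n}(\mathsf v,\delta_1)$, $\mathsf v\in\mathbb N^n$, are in canonical bijection with the $D_n$ posets of type $\omega_1$. The bijection sends a $D_n$ poset $\mathcal P$ of type $\omega_1$ to the quiver variety $\mathcal M_{D_n}(\mathsf v,\delta_1)$ with $\mathsf v_i$ equal to the number of elements of $\mathcal P$ of color $i$, for $1\le i\le n$.
   Context: $\mathbb N=\{0,1,2,\dots\}$; $\delta_1=(1,0,\dots,0)\in\mathbb N^n$. The quiver $D_n$ has vertices $Q_0=\{1,\dots,n\}$ and arrows $Q_1$: $i\to i+1$ for $1\le i\le n-2$, and $n-2\to n$; an arrow $e$ goes from $o(e)$ to $i(e)$. **Quiver variety.** For $\mathsf v,\mathsf w\in\mathbb N^n$ let $V_i,W_i$ be complex vector spaces with $\dim V_i=\mathsf v_i$, $\dim W_i=\mathsf w_i$. Consider tuples $(X_e,Y_e,A_i,B_i)$ with $X_e\in\mathrm{Hom}(V_{o(e)},V_{i(e)})$, $Y_e\in\mathrm{Hom}(V_{i(e)},V_{o(e)})$, $A_i\in\mathrm{Hom}(W_i,V_i)$, $B_i\in\mathrm{Hom}(V_i,W_i)$ satisfying the moment map equations $\sum_{i(e)=i}X_eY_e-\sum_{o(e)=i}Y_eX_e+A_iB_i=0$ for all $i$. A tuple is stable if the only collection of subspaces $S_i\subset V_i$ with $\mathrm{Im}(A_i)\subset S_i$, $X_e(S_{o(e)})\subset S_{i(e)}$, $Y_e(S_{i(e)})\subset S_{o(e)}$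 is $S_i=V_i$. $\mathcal M_{D_n}(\mathsf v,\mathsf w)$ is the quotient of the set of stable tuples satisfying the moment map equations by $\prod_i GL(V_i)$ (the GIT quotient for stability parameter $(1,\dots,1)$), a smooth quasi-projective variety. **Fundamental poset.** The type $D_n$ fundamental representation poset has elements $d_{i,1},d_{i,2}$ for $1\le i\le n-2$, together with $d_{n-1,1}$ and $d_{n,1}$. Its partial order is generated by: $d_{i,1}\le d_{i+1,1}$ for $1\le i\le n-2$; $d_{i,2}\ge d_{i+1,2}$ for $1\le i\le n-3$; $d_{n-2,1}\le d_{n,1}$, $d_{n-2,2}\ge d_{n,1}$, $d_{n-2,2}\ge d_{n-1,1}$. The element $d_{i,j}$ has color $i$. It also carries the weight function $\mathrm{wt}(d_{i,1})=1$ for $1\le i\le n$ and $\mathrm{wt}(d_{i,2})=\hbar^{n-i-1}$ for $1\le i\le n-2$. A $D_n$ poset of type $\omega_1$ is an order ideal (down-set, possibly empty) of this poset with the induced coloring and weights. *)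

(* Defs.v *)
From HB Require Import structures.
From mathcomp Require Import all_boot all_order all_algebra zify.
From mathcomp Require Import boolp classical_sets functions.

Set Implicit Arguments.
Unset Strict Implicit.
Unset Printing Implicit Defensive.

Import Order.TTheory GRing.Theory.

Local Open Scope ring_scope.
Local Open Scope classical_set_scope.

Section KrullDimension.
Variables (T : Type) (closed : set (set T)).

Definition irreducible (Z : set T) :=
  Z !=set0 /\
  forall F1 F2, closed F1 -> closed F2 ->
    Z `<=` F1 `|` F2 -> Z `<=` F1 \/ Z `<=` F2.

Definition irreducible_chain (d : nat) :=
  exists Z : nat -> set T,
    (forall i, (i <= d)%N -> closed (Z i) /\ irreducible (Z i)) /\
    (forall i, (i < d)%N -> Z i `<` Z i.+1).

(* The longest chain Z_0 < ... < Z_d has length d.  The empty space does not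
   have any dimension in this sense. *)
Definition has_krull_dim (d : nat) :=
  irreducible_chain d /\ ~ irreducible_chain d.+1.

End KrullDimension.

Record quiver := Quiver {
  vertex : finType;
  arrow : finType;
  tail : arrow -> vertex;
  head : arrow -> vertex }.

Section QuiverVariety.
Variables (F : fieldType) (Q : quiver) (V W : vertex Q -> vectType F).

Record framed_rep := FramedRep {
  repX : forall e : arrow Q, 'Hom(V (tail e), V (head e));
  repY : forall e : arrow Q, 'Hom(V (head e), V (tail e));
  repA : forall i : vertex Q, 'Hom(W i, V i);
  repB : forall i : vertex Q, 'Hom(V i, W i) }.

(* [f] transported to End(V_i) when [j = i], and 0 when [j != i]. *)
Definition end_at (i j : vertex Q) (f : 'End(V j)) : 'End(V i) :=
  untag 0 (fun h : 'End(V i) => h) (Tagged (fun k => 'End(V k)) f).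

Definition moment_map (r : framed_rep) (i : vertex Q) : 'End(V i) :=
  \sum_(e : arrow Q) end_at i (repX r e \o repY r e)%VF
  - \sum_(e : arrow Q) end_at i (repY r e \o repX r e)%VF
  + (repA r i \o repB r i)%VF.

Definition stable (r : framed_rep) :=
  forall S : forall i, {vspace V i},
    (forall i, limg (repA r i) <= S i)%VS ->
    (forall e, repX r e @: S (tail e) <= S (head e))%VS ->
    (forall e, repY r e @: S (head e) <= S (tail e))%VS ->
    forall i, S i = fullv.

Definition stable_locus : set framed_rep :=
  [set r | (forall i, moment_map r i = 0) /\ stable r].

Definition in_GL (g : forall i, 'End(V i)) := forall i, lker (g i) == 0%VS.

Definition GL_act (g : forall i, 'End(V i)) (r : framed_rep) : framed_rep :=
  FramedRep
    (fun e => g (head e) \o repX r e \o (g (tail e))^-1)%VF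
    (fun e => g (tail e) \o repY r e \o (g (head e))^-1)%VF
    (fun i => g i \o repA r i)%VF
    (fun i => repB r i \o (g i)^-1)%VF.

Definition GL_orbit (r : framed_rep) : set framed_rep :=
  [set r' | exists g, in_GL g /\ r' = GL_act g r].

(* The set of points of the quiver variety. *)
Definition quiver_variety : set (set framed_rep) := GL_orbit @` stable_locus.

(* Polynomials in the matrix coefficients of X, Y, A and B. *)
Inductive polynomial_function : (framed_rep -> F) -> Prop :=
| poly_const c : polynomial_function (fun _ => c)
| poly_X e (u : V (tail e)) (phi : 'Hom(V (head e), F^o)) :
    polynomial_function (fun r => phi (repX r e u))
| poly_Y e (u : V (head e)) (phi : 'Hom(V (tail e), F^o)) :
    polynomial_function (fun r => phi (repY r e u))
| poly_A i (u : W i) (phi : 'Hom(V i, F^o)) :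
    polynomial_function (fun r => phi (repA r i u))
| poly_B i (u : V i) (phi : 'Hom(W i, F^o)) :
    polynomial_function (fun r => phi (repB r i u))
| poly_add p q : polynomial_function p -> polynomial_function q ->
    polynomial_function (fun r => p r + q r)
| poly_mul p q : polynomial_function p -> polynomial_function q ->
    polynomial_function (fun r => p r * q r).

(* The variety is a geometric quotient of the stable locus, hence its Zariski
   topology is the quotient topology: a set of orbits is closed when its
   preimage is cut out of the stable locus by polynomial equations. *)
Definition variety_closed : set (set (set framed_rep)) :=
  [set Z | Z `<=` quiver_variety /\
    exists P : set (framed_rep -> F), P `<=` polynomial_function /\
      forall r, stable_locus r ->
        (Z (GL_orbit r) <-> forall p, P p -> p r = 0)].

Definition variety_dim (d : nat) := has_krull_dim variety_closed d.

End QuiverVariety.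

Arguments quiver_variety {F Q} V W.
Arguments variety_dim {F Q} V W d.

(* V_i = F^(v_i) as spaces of column vectors. *)
Definition coord_space (F : fieldType) (I : finType) (v : {ffun I -> nat})
    (i : I) : vectType F :=
  'cV[F]_(v i).

Definition nakajima_variety (F : fieldType) (Q : quiver)
    (v w : {ffun vertex Q -> nat}) :=
  quiver_variety (coord_space F v) (coord_space F w).

Definition nakajima_dim (F : fieldType) (Q : quiver)
    (v w : {ffun vertex Q -> nat}) (d : nat) :=
  variety_dim (coord_space F v) (coord_space F w) d.

Arguments nakajima_variety F Q v w : clear implicits.
Arguments nakajima_dim F Q v w d : clear implicits.

(* The vertices 1, ..., n are the labels of the elements of 'I_n. *)
Definition label n (i : 'I_n) : nat := i.+1.

Definition D_adj n (i j : 'I_n) : bool :=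
  let a := label i in let b := label j in
  ((a <= n - 2) && (b == a + 1) || (a == n - 2) && (b == n))%N.

Definition D_arrow n := {e : 'I_n * 'I_n | D_adj e.1 e.2}.

Definition D_quiver n : quiver :=
  @Quiver 'I_n (D_arrow n) (fun e => (val e).1) (fun e => (val e).2).

Definition delta1 n : {ffun 'I_n -> nat} := [ffun i => nat_of_bool (label i == 1%N)].

(* d_{i,1} is encoded as (i, false) and d_{i,2} as (i, true). *)
Record D_fund n := DFund {
  fund_val : 'I_n * bool;
  _ : fund_val.2 ==> (label fund_val.1 <= n - 2)%N }.

HB.instance Definition _ n := [isSub for @fund_val n].
HB.instance Definition _ n := [Finite of D_fund n by <:].

Definition color n (d : D_fund n) : 'I_n := (val d).1.
Definition second n (d : D_fund n) : bool := (val d).2.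

(* Weights are polynomials in the formal variable hbar = 'X.  An order ideal
   carries the restrictions of [color] and [fund_wt]. *)
Definition fund_wt n (d : D_fund n) : {poly int} :=
  if second d then 'X^(n - label (color d) - 1) else 1.

(* The generating relations x <= y of the partial order. *)
Definition fund_gen n (x y : D_fund n) : bool :=
  let a := label (color x) in let b := label (color y) in
  match second x, second y with
  | false, false => (a <= n - 2) && (b == a + 1) || (a == n - 2) && (b == n)
  | true, true => (b <= n - 3) && (a == b + 1)
  | false, true => (b == n - 2) && ((a == n) || (a == n - 1))
  | true, false => false
  end%N.

Definition fund_le n : rel (D_fund n) := connect (@fund_gen n).

Definition fund_rank n (x : D_fund n) : nat :=
  if second x then (2 * n - label (color x))%N else label (color x).

Lemma fund_gen_rank n (x y : D_fund n) :
  fund_gen x y -> (fund_rank x < fund_rank y)%N.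
Proof.
rewrite /fund_gen /fund_rank.
have := ltn_ord (color x); have := ltn_ord (color y); rewrite /label.
by case: (second x); case: (second y); lia.
Qed.

Lemma fund_le_rank n (x y : D_fund n) :
  fund_le x y -> x = y \/ (fund_rank x < fund_rank y)%N.
Proof.
case/connectP => p; elim: p x => [|z p IHp] x /= => [_ ->|]; first by left.
case/andP => /fund_gen_rank xz zp yE; right.
by case: (IHp z zp yE) => [<- //|]; apply: ltn_trans.
Qed.

Lemma fund_le_refl n : reflexive (@fund_le n).
Proof. exact: connect0. Qed.

Lemma fund_le_trans n : transitive (@fund_le n).
Proof. by move=> y x z; apply: connect_trans. Qed.

Lemma fund_le_anti n : antisymmetric (@fund_le n).
Proof.
move=> x y /andP[/fund_le_rank[//|xy] /fund_le_rank[//|yx]].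
by have := ltn_trans xy yx; rewrite ltnn.
Qed.

Fact fund_display : Order.disp_t. Proof. exact: (Order.Disp tt tt). Qed.

HB.instance Definition _ n := Order.Le_isPOrder.Build fund_display (D_fund n)
  (@fund_le_refl n) (@fund_le_anti n) (@fund_le_trans n).

(* The D_n posets of type omega_1. *)
Definition is_D_poset n (P : {set D_fund n}) : Prop :=
  forall x y : D_fund n, (x <= y)%O -> y \in P -> x \in P.

Definition color_count n (P : {set D_fund n}) : {ffun 'I_n -> nat} :=
  [ffun i => #|[set x in P | color x == i]%SET|].

(* Main.v *)
(* A stable point is generated by the framing vector.  Let a_i be its image at
   vertex i under the X-arrows, let b_(n-2) = Y a_(n-1) = - Y a_n, and let b_i
   be the images of b_(n-2) under the Y-arrows going back to vertex 1.  Taking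
   traces in the moment map equations gives B A = 0, and then the equations
   force Y a = 0 away from the two legs, X b = 0 and B = 0.  Hence V_i is
   spanned by a_i and b_i, the nonzero ones are linearly independent, and their
   supports satisfy exactly the conditions that define an order ideal, a_i and
   b_i being in the role of d_(i,1) and d_(i,2).  Two stable points with the
   same dimension vector differ by the change of basis that matches their
   vectors a_i, b_i, so every nonempty variety is a single point. *)
Require Import Defs.
From mathcomp Require Import all_boot all_order all_algebra zify.
From mathcomp Require Import boolp classical_sets functions reals.
From mathcomp.real_closed Require Import complex.

Set Implicit Arguments.
Unset Strict Implicit.
Unset Printing Implicit Defensive.

Import Order.TTheory GRing.Theory.

Local Open Scope ring_scope.
Local Open Scope classical_set_scope.

(** * Transport of endomorphisms between vertices *)

Section EndAt.
Variables (F : fieldType) (Q : quiver) (V : vertex Q -> vectType F).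

Lemma end_at_id i (f : 'End(V i)) : end_at i f = f.
Proof.
have e : tag (Tagged (fun k => 'End(V k)) f) = i by [].
(* Equality of vertices is decidable, so every proof of [i = i] is [erefl] and the transport does
   nothing. *)
by rewrite /end_at (untagE _ _ e) (eq_axiomK e).
Qed.

Lemma end_at_neq i j (f : 'End(V j)) : j != i -> end_at i f = 0.
Proof. by move=> ji; rewrite /end_at untag_dflt. Qed.

Lemma end_at0 i j : end_at i (0 : 'End(V j)) = 0.
Proof. by rewrite /end_at /untag; case: eqP => //= e; case: _ / e. Qed.

End EndAt.

Import passmx.

(** * Traces of endomorphisms of abstract vector spaces *)

Section LinearTrace.
Variable F : fieldType.

Definition lftrace (U : vectType F) (f : 'End(U)) : F :=
  \tr (mxof (vbasis {:U}) (vbasis {:U}) f).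

Lemma lftraceD (U : vectType F) (f g : 'End(U)) :
  lftrace (f + g) = lftrace f + lftrace g.
Proof. by rewrite /lftrace !linearD. Qed.

Lemma lftraceZ (U : vectType F) c (f : 'End(U)) :
  lftrace (c *: f) = c * lftrace f.
Proof. by rewrite /lftrace !linearZ. Qed.

Lemma lftrace0 (U : vectType F) : lftrace (0 : 'End(U)) = 0.
Proof. by rewrite /lftrace !linear0. Qed.

Lemma lftraceN (U : vectType F) (f : 'End(U)) : lftrace (- f) = - lftrace f.
Proof. by rewrite /lftrace !linearN. Qed.

Lemma lftrace_sum (U : vectType F) (I : finType) (f : I -> 'End(U)) :
  lftrace (\sum_i f i) = \sum_i lftrace (f i).
Proof. by rewrite /lftrace !linear_sum. Qed.

Lemma lftrace_comp (U U' : vectType F) (f : 'Hom(U, U')) (g : 'Hom(U', U)) :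
  lftrace (g \o f)%VF = lftrace (f \o g)%VF.
Proof.
rewrite /lftrace.
rewrite (mxof_comp _ _ (vbasisP {:U'})).
rewrite (mxof_comp _ _ (vbasisP {:U})).
exact: mxtrace_mulC.
Qed.

Lemma lftrace1 (U : vectType F) : lftrace (\1 : 'End(U))%VF = (dim U)%:R.
Proof.
rewrite /lftrace mxof1 ?(basis_free (vbasisP _)) //.
by rewrite mxtrace1 dimvf.
Qed.

End LinearTrace.

(** * Representations of the $D_n$ quiver, with arrows read as pairs of zero-based vertices *)

Lemma D_adjE n (i j : 'I_n) : (4 <= n)%N ->
  D_adj i j = (i.+1 == j :> nat) && (j < n.-1)%N
              || (i == n - 3 :> nat)%N && (j == n.-1 :> nat).
Proof. by rewrite /D_adj /label => n4; have := ltn_ord j; lia. Qed.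

Section DRep.
Variables (F : fieldType) (n : nat) (V W : 'I_n -> vectType F).
Notation rep := (@framed_rep F (D_quiver n) V W).
Variable r : rep.

Definition D_arr (i j : 'I_n) (H : D_adj i j) : arrow (D_quiver n) :=
  exist (fun e : 'I_n * 'I_n => D_adj e.1 e.2) (i, j) H.

(* Total in (i, j), with value 0 when there is no arrow i -> j: the indices are
   then free of the equations relating [tail e] and [head e] to vertices. *)
Definition Xmap i j : 'Hom(V i, V j) :=
  if decP (@idP (D_adj i j)) is left H then repX r (D_arr H) else 0.

Definition Ymap i j : 'Hom(V j, V i) :=
  if decP (@idP (D_adj i j)) is left H then repY r (D_arr H) else 0.

Lemma XmapE i j (H : D_adj i j) : Xmap i j = repX r (D_arr H).
Proof.
by rewrite /Xmap; case: decP => // H'; rewrite (bool_irrelevance H H').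
Qed.

Lemma YmapE i j (H : D_adj i j) : Ymap i j = repY r (D_arr H).
Proof.
by rewrite /Ymap; case: decP => // H'; rewrite (bool_irrelevance H H').
Qed.

Lemma Xmap0 i j : ~~ D_adj i j -> Xmap i j = 0.
Proof. by rewrite /Xmap; case: decP => // Hij /negP. Qed.

Lemma Ymap0 i j : ~~ D_adj i j -> Ymap i j = 0.
Proof. by rewrite /Ymap; case: decP => // Hij /negP. Qed.

Lemma D_arrow_ind (P : arrow (D_quiver n) -> Prop) :
  (forall i j (H : D_adj i j), P (D_arr H)) -> forall e, P e.
Proof. by move=> H [[i j] /= Hij]; apply: H. Qed.

(** Turns a sum over the sigma type of arrows into a double sum over vertices, which can be
    exchanged and split freely. *)
Lemma sum_D_arrow (U : nmodType) (f : arrow (D_quiver n) -> U)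
    (g : 'I_n -> 'I_n -> U) :
  (forall i j (H : D_adj i j), f (D_arr H) = g i j) ->
  (forall i j, ~~ D_adj i j -> g i j = 0) ->
  \sum_e f e = \sum_i \sum_j g i j.
Proof.
move=> fg g0; rewrite pair_big /=.
rewrite (bigID (fun e : 'I_n * 'I_n => D_adj e.1 e.2)) /=.
rewrite [X in _ + X]big1 ?addr0; last by move=> [i j] /=; apply: g0.
rewrite (reindex_omap (val : D_arrow n -> 'I_n * 'I_n) insub) /=; last first.
  by move=> e eA; rewrite insubT.
apply: eq_big => [[e eA]|[[i j] H] _] /=; first by rewrite insubT eA /= eqxx.
exact: fg.
Qed.

(** In the double sum over vertices, [end_at] kills every term not based at [i] and is the identity
    on the others. *)
Lemma moment_mapE i : moment_map r i =
  \sum_j (Xmap j i \o Ymap j i)%VF - \sum_j (Ymap i j \o Xmap i j)%VF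
  + (repA r i \o repB r i)%VF.
Proof.
rewrite /moment_map; congr (_ - _ + _).
- rewrite (@sum_D_arrow _ _ (fun k j => @end_at _ (D_quiver n) V i j
    (Xmap k j \o Ymap k j)%VF)).
  + rewrite exchange_big (bigD1 i) //= [X in _ + X]big1 ?addr0.
      by apply: eq_bigr => j _; rewrite end_at_id.
    by move=> j ji; rewrite big1 // => k _; apply: end_at_neq.
  + by move=> k j H; rewrite (XmapE H) (YmapE H).
  + by move=> k j H; rewrite Xmap0 // comp_lfun0l end_at0.
- rewrite (@sum_D_arrow _ _ (fun j k => @end_at _ (D_quiver n) V i j
    (Ymap j k \o Xmap j k)%VF)).
  + rewrite (bigD1 i) //= [X in _ + X]big1 ?addr0.
      by apply: eq_bigr => j _; rewrite end_at_id.
    by move=> j ji; rewrite big1 // => k _; apply: end_at_neq.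
  + by move=> k j H; rewrite (XmapE H) (YmapE H).
  + by move=> k j H; rewrite Xmap0 // comp_lfun0r end_at0.
Qed.

(** In the total trace of the moment map, the arrow terms cancel because $XY$ and $YX$ have the same
    trace. *)
Lemma sum_trace_AB : (forall i, moment_map r i = 0) ->
  \sum_i lftrace (repA r i \o repB r i)%VF = 0.
Proof.
move=> mr.
have : \sum_i lftrace (moment_map r i) = 0.
  by apply: big1 => i _; rewrite mr lftrace0.
under eq_bigr => i _ do
  rewrite moment_mapE !lftraceD lftraceN !lftrace_sum.
rewrite big_split /= big_split /= sumrN [X in X - _]exchange_big /=.
suff -> : \sum_j \sum_i lftrace (Xmap j i \o Ymap j i)%VF =
          \sum_i \sum_j lftrace (Ymap i j \o Xmap i j)%VF.
  by rewrite subrr add0r.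
by apply: eq_bigr => i _; apply: eq_bigr => j _; rewrite lftrace_comp.
Qed.

Lemma stableE : stable r <-> forall S : forall i, {vspace V i},
    (forall i, limg (repA r i) <= S i)%VS ->
    (forall i j, Xmap i j @: S i <= S j)%VS ->
    (forall i j, Ymap i j @: S j <= S i)%VS ->
    forall i, S i = fullv.
Proof.
split=> st S SA SX SY; apply: st => //.
- by apply: D_arrow_ind => i j H; rewrite -XmapE.
- by apply: D_arrow_ind => i j H; rewrite -YmapE.
- move=> i j; case: (boolP (D_adj i j)) => H; last first.
    by rewrite Xmap0 // lim0g sub0v.
  by rewrite (XmapE H); exact: (SX (D_arr H)).
- move=> i j; case: (boolP (D_adj i j)) => H; last first.
    by rewrite Ymap0 // lim0g sub0v.
  by rewrite (YmapE H); exact: (SY (D_arr H)).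
Qed.

End DRep.

(** * Base change, orbits and one-point varieties *)

Lemma inv_lfun_comp (F : fieldType) (U : vectType F) (f g : 'End(U)) :
  lker f == 0%VS -> lker g == 0%VS -> (f \o g)^-1%VF = (g^-1 \o f^-1)%VF.
Proof.
move=> f0 g0; have fg0 : lker (f \o g)%VF == 0%VS.
  by apply/lker0P => x y; rewrite !comp_lfunE => /(lker0P f0) /(lker0P g0).
have fgE : ((f \o g) \o (g^-1 \o f^-1))%VF = \1%VF.
  by rewrite -comp_lfunA (lker0_compVKf g0) lker0_compfV.
by rewrite -[LHS]comp_lfun1r -fgE (lker0_compKf fg0).
Qed.

Section GroupAction.
Variables (F : fieldType) (Q : quiver) (V W : vertex Q -> vectType F).
Implicit Types (g h : forall i, 'End(V i)) (r : framed_rep V W).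

Lemma eq_framed_rep r r' :
  (forall e, repX r e = repX r' e) -> (forall e, repY r e = repY r' e) ->
  (forall i, repA r i = repA r' i) -> (forall i, repB r i = repB r' i) ->
  r = r'.
Proof.
case: r r' => X Y A B [X' Y' A' B'] /= XE YE AE BE.
congr FramedRep; apply: functional_extensionality_dep.
- exact: XE.
- exact: YE.
- exact: AE.
- exact: BE.
Qed.

Lemma in_GL_comp g h : in_GL g -> in_GL h -> in_GL (fun i => h i \o g i)%VF.
Proof.
move=> g0 h0 i; apply/lker0P => x y; rewrite !comp_lfunE.
by move=> /(lker0P (h0 i)) /(lker0P (g0 i)).
Qed.

Lemma in_GL_inv g : in_GL g -> in_GL (fun i => (g i)^-1)%VF.
Proof.
by move=> g0 i; apply/lker0P; apply: can_inj (lker0_lfunVK (g0 i)).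
Qed.

Lemma GL_act_comp g h r : in_GL g -> in_GL h ->
  GL_act h (GL_act g r) = GL_act (fun i => h i \o g i)%VF r.
Proof.
move=> g0 h0; apply: eq_framed_rep => [e|e|i|i] /=;
  by rewrite ?inv_lfun_comp // !comp_lfunA.
Qed.

Lemma GL_actK g r : in_GL g -> GL_act (fun i => (g i)^-1)%VF (GL_act g r) = r.
Proof.
move=> g0; rewrite GL_act_comp //; last exact: in_GL_inv.
have inv1 (U : vectType F) : (\1^-1)%VF = \1%VF :> 'End(U).
  rewrite -[LHS]comp_lfun1r lker0_compVf //.
  by apply/lker0P => x y; rewrite !id_lfunE.
by apply: eq_framed_rep => [e|e|i|i] /=;
  rewrite !lker0_compVf // ?inv1 ?comp_lfun1r ?comp_lfun1l.
Qed.

Lemma GL_orbit_act g r : in_GL g -> GL_orbit (GL_act g r) = GL_orbit r.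
Proof.
move=> g0; apply/seteqP; split=> [_ [h [h0 ->]]|_ [h [h0 ->]]].
  by eexists; split; last exact: GL_act_comp; apply: in_GL_comp.
exists (fun i => h i \o (g i)^-1)%VF; split.
  by apply: in_GL_comp => //; apply: in_GL_inv.
rewrite -GL_act_comp ?GL_actK //; first exact: in_GL_inv.
Qed.

(** A chain of length 1 would need two distinct nonempty subsets of a point. *)
Lemma variety_dim_point (p : set (framed_rep V W)) :
  quiver_variety V W = [set p] -> variety_dim V W 0.
Proof.
move=> Mp; have Mp_closed : variety_closed (V := V) (W := W) [set p].
  split; first by rewrite Mp.
  (* The empty system of equations cuts out the whole stable locus. *)
  exists set0; split=> // r sr; split=> // _.
  by rewrite /= -[_ = p]/([set p] _) -Mp; exists r.
split; first exists (fun=> [set p]).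
  split=> // i _; split=> //; split; first by exists p.
  move=> F1 F2 _ _ sF; case: (sF p erefl) => Fp; [left|right] => _ -> //.
case=> Z [ZP Zlt].
have [[Z1p _] _] := ZP 1%N isT; have [_ [[q Z0q] _]] := ZP 0%N isT.
have [Z01 nZ10] := Zlt 0%N isT; apply: nZ10 => s Z1s.
have := Z1p _ (Z01 _ Z0q); have := Z1p _ Z1s; rewrite Mp /= => -> <-.
exact: Z0q.
Qed.

End GroupAction.

(** * Shape of the $D_n$ tree *)

Section Combinatorics.
Variable n : nat.
Hypothesis n4 : (4 <= n)%N.
Implicit Types i j k : 'I_n.

(* Vertices are counted from 0: the leaves are n - 2 and n - 1, and n - 3 is the
   branching vertex. *)
Definition leaf i := (n - 2 <= i)%N.

Lemma D_adj_lt i j : D_adj i j -> (i < j)%N.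
Proof. by rewrite D_adjE //; lia. Qed.

Lemma D_adj_parent i k j : D_adj i j -> D_adj k j -> i = k.
Proof. by rewrite !D_adjE // => ij kj; apply/val_inj => /=; lia. Qed.

Lemma D_adj_child i j k : D_adj i j -> ~~ leaf j -> D_adj i k -> k = j.
Proof. by rewrite !D_adjE // /leaf => ij lj kj; apply/val_inj => /=; lia. Qed.

(** The parent of a leaf is the branching vertex, whose children are exactly the two leaves. *)
Lemma D_adj_leafP i j k : D_adj i j -> leaf j -> D_adj i k = leaf k.
Proof.
by have := ltn_ord j; have := ltn_ord k; rewrite !D_adjE // /leaf; lia.
Qed.

Lemma has_parent j : (0 < j)%N -> exists i, D_adj i j.
Proof.
move=> j0; have jn := ltn_ord j.
have [jl|jl] := eqVneq (j : nat) n.-1.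
  have pn : (n - 3 < n)%N by lia.
  by exists (Ordinal pn); rewrite D_adjE //=; lia.
have pn : (j.-1 < n)%N by lia.
by exists (Ordinal pn); rewrite D_adjE //=; lia.
Qed.

(** The disjunction serves inductions on the $b_i$: they pass to an inner child, or stop at the leaf
    of sign $+1$. *)
Lemma has_child i : ~~ leaf i ->
  exists2 j, D_adj i j & j = n.-2 :> nat \/ ~~ leaf j.
Proof.
rewrite /leaf => li; have jn : (i.+1 < n)%N by lia.
by exists (Ordinal jn); rewrite ?D_adjE /leaf //=; lia.
Qed.

Lemma leaf_D_adj i j : leaf i -> ~~ D_adj i j.
Proof.
by have := ltn_ord i; have := ltn_ord j; rewrite /leaf D_adjE //; lia.
Qed.

Lemma parent_of_root i j : i = 0%N :> nat -> ~~ D_adj j i.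
Proof. by rewrite D_adjE // => i0; lia. Qed.

Lemma leafP i : leaf i -> i = n.-2 :> nat \/ i = n.-1 :> nat.
Proof. by have := ltn_ord i; rewrite /leaf; lia. Qed.

End Combinatorics.

(** Recursion along [rank] for a dependent family: iterating [G] from [x0], the value at [i] is
    stationary after [(rank i).+1] steps. *)
Lemma dependent_fixpoint n (T : 'I_n -> Type) (x0 : forall i, T i)
    (G : (forall i, T i) -> forall i, T i) (rank : 'I_n -> nat) :
  (forall x y i, (forall j, (rank j < rank i)%N -> x j = y j) ->
    G x i = G y i) ->
  exists x, forall i, x i = G x i.
Proof.
move=> Gloc; pose x := fix x k := if k is k'.+1 then G (x k') else x0.
have xst k i m : (rank i < k)%N -> (k <= m)%N -> x m i = x k i.
  elim: k i m => // k IH i [|m] // ik km; apply: Gloc => j ji.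
  by apply: IH; lia.
exists (fun i => x (rank i).+1 i) => i; apply: Gloc => j ji.
exact: (xst (rank j).+1 j (rank i)).
Qed.

(** * Frames, and their extraction from a stable point *)

Section Frames.
Variables (F : fieldType) (n : nat) (V : 'I_n -> vectType F).
Hypothesis n4 : (4 <= n)%N.
Notation W := (coord_space F (delta1 n)).
Notation rep := (@framed_rep F (D_quiver n) V W).
Implicit Type r : rep.

(** One formula for all vertices: a generator of $W_0$, and the empty column elsewhere. *)
Definition framing (i : 'I_n) : W i := const_mx 1.

Lemma framing_span i (w : W i) : exists c, w = c *: framing i.
Proof.
have d1 : (delta1 n i <= 1)%N by rewrite ffunE; case: eqP.
move: w; rewrite /framing /coord_space.
move: (delta1 n i) d1 => [|[|//]] _ w.
  by exists 0; apply/matrixP => -[].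
by exists (w 0 0); apply/matrixP => k l; rewrite !mxE mulr1 !ord1.
Qed.

Lemma framing_eq0 (i : 'I_n) (w : W i) : (0 < i)%N -> w = 0.
Proof.
move=> i0; have d0 : delta1 n i = 0%N by rewrite ffunE /label eqSS eqn0Ngt i0.
move: w; rewrite /coord_space.
by move: (delta1 n i) d0 => [|//] _ w; apply/matrixP => -[].
Qed.

(** The moment map at the branching vertex forces opposite signs on the two legs. The value 0
    elsewhere encodes $Y a = 0$, so that one formula covers every arrow. *)
Definition leg_sign (j : 'I_n) : F :=
  if j == n.-2 :> nat then 1 else if j == n.-1 :> nat then -1 else 0.

(** The normal form of a stable point. The vectors may vanish, and their independence is derived
    afterwards. *)
Record frame r (a b : forall i, V i) : Prop := Frame {
  frame_A : forall i : 'I_n, i = 0%N :> nat -> repA r i (framing i) = a i;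
  frame_Xa : forall i j : 'I_n, D_adj i j -> Xmap r i j (a i) = a j;
  frame_Xb : forall i j : 'I_n, Xmap r i j (b i) = 0;
  frame_Ya : forall i j : 'I_n, D_adj i j ->
    Ymap r i j (a j) = leg_sign j *: b i;
  frame_Yb : forall i j : 'I_n, D_adj i j -> ~~ leaf j ->
    Ymap r i j (b j) = b i;
  frame_leaf : forall i : 'I_n, leaf i -> b i = 0;
  frame_B : forall i : 'I_n, repB r i = 0;
  frame_span : forall i : 'I_n, (<[a i]> + <[b i]>)%VS = fullv }.

Section Moment.
Variable r : rep.
Hypothesis mr : forall i, moment_map r i = 0.

Lemma repB_eq0 (i : 'I_n) : (0 < i)%N -> repB r i = 0.
Proof.
move=> i0; apply/lfunP => w; rewrite zero_lfunE; exact: framing_eq0.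
Qed.

Lemma repA_eq0 (i : 'I_n) : (0 < i)%N -> repA r i = 0.
Proof.
by move=> i0; apply/lfunP => w; rewrite (framing_eq0 w i0) !linear0.
Qed.

(** Only vertex 0 contributes to [sum_trace_AB], and there $BA$ acts on a line, hence is the scalar
    given by its trace. *)
Lemma repBA_eq0 i : (repB r i \o repA r i)%VF = 0.
Proof.
have [i0|i0] := posnP i; last by rewrite repB_eq0 // comp_lfun0l.
have tr0 : lftrace (repB r i \o repA r i)%VF = 0.
  have := sum_trace_AB mr; rewrite (bigD1 i) //= big1 => [|j ji].
    by rewrite addr0 lftrace_comp.
  rewrite repB_eq0 ?comp_lfun0r ?lftrace0 // lt0n.
  by apply: contraNneq ji => j0; apply/eqP/val_inj; rewrite /= i0 j0.
have [c Ec] := framing_span ((repB r i \o repA r i)%VF (framing i)).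
have BA : (repB r i \o repA r i)%VF = c *: \1%VF.
  apply/lfunP => w; have [d ->] := framing_span w.
  rewrite scale_lfunE id_lfunE [LHS]linearZ /=. rewrite [X in d *: X]Ec.
  by rewrite !scalerA mulrC.
move: tr0; rewrite BA lftraceZ lftrace1 dim_matrix /delta1 ffunE /label i0.
by rewrite mulr1 => ->; rewrite scale0r.
Qed.

Lemma moment_at i v :
  \sum_j Xmap r j i (Ymap r j i v) - \sum_j Ymap r i j (Xmap r i j v)
  + repA r i (repB r i v) = 0.
Proof.
have := congr1 (fun f : 'End(V i) => f v) (mr i).
rewrite moment_mapE zero_lfunE !(add_lfunE, opp_lfunE, sum_lfunE) comp_lfunE.
under eq_bigr => j _ do rewrite comp_lfunE.
by under [X in _ - X]eq_bigr => j _ do rewrite comp_lfunE.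
Qed.

(** This lemma and the next two use the tree shape to reduce the sums in the moment map to one or
    two terms. *)
Lemma sum_parent (i p : 'I_n) (f : forall j, V j) : D_adj p i ->
  \sum_j Xmap r j i (f j) = Xmap r p i (f p).
Proof.
move=> pi; rewrite (bigD1 p) //= big1 ?addr0 // => j jp.
rewrite Xmap0 ?zero_lfunE //; apply: contraNN jp => ji.
by rewrite (D_adj_parent n4 ji pi).
Qed.

Lemma sum_child (i j : 'I_n) (f : forall j, V j) : D_adj i j -> ~~ leaf j ->
  \sum_k Ymap r i k (f k) = Ymap r i j (f j).
Proof.
move=> ij lj; rewrite (bigD1 j) //= big1 ?addr0 // => k kj.
rewrite Ymap0 ?zero_lfunE //; apply: contraNN kj => ik.
by rewrite (D_adj_child n4 ij lj ik).
Qed.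

Lemma sum_legs (i l1 l2 : 'I_n) (f : forall j, V j) : D_adj i l1 ->
  l1 = n.-2 :> nat -> l2 = n.-1 :> nat ->
  \sum_k Ymap r i k (f k) = Ymap r i l1 (f l1) + Ymap r i l2 (f l2).
Proof.
move=> il e1 e2; have l12 : l2 != l1.
  by apply: contraTneq n4 => l12; move: e2; rewrite l12 e1; lia.
rewrite (bigD1 l1) //= (bigD1 l2) //= [X in _ + (_ + X)]big1 ?addr0 // => k.
case/andP=> k1 k2; rewrite Ymap0 ?zero_lfunE //.
have lk : leaf l1 by rewrite /leaf e1; lia.
rewrite (D_adj_leafP n4 k il lk); apply: contraNN k1 => /leafP[]// ek.
  by apply/eqP/val_inj; rewrite /= ek e1.
by case/eqP: k2; apply/val_inj; rewrite /= ek e2.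
Qed.

Lemma frame_exists : stable r -> exists a b, frame r a b.
Proof.
move=> sr.
(* The framing term matters at vertex 0 only; elsewhere the sum is the image of the vector at the
   unique parent. *)
have [a aE] : exists a : forall i, V i, forall i,
    a i = repA r i (framing i) + \sum_j Xmap r j i (a j).
  apply: (@dependent_fixpoint _ V (fun=> 0) _ (fun i => val i)) => x y i xy.
  congr (_ + _); apply: eq_bigr => j _.
  have [ji|/Xmap0->] := boolP (D_adj j i); last by rewrite !zero_lfunE.
  by rewrite xy //=; apply: D_adj_lt.
have aA (i : 'I_n) : i = 0%N :> nat -> repA r i (framing i) = a i.
  move=> i0; rewrite aE big1 ?addr0 // => j _.
  by rewrite Xmap0 ?zero_lfunE // parent_of_root.
have Xa (i j : 'I_n) : D_adj i j -> Xmap r i j (a i) = a j.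
  move=> ij; rewrite [RHS]aE (sum_parent a ij) repA_eq0 ?zero_lfunE ?add0r //.
  by apply: leq_ltn_trans (D_adj_lt n4 ij).
have Ba (i : 'I_n) : repB r i (a i) = 0.
  have [i0|i0] := posnP i; last by rewrite repB_eq0 // zero_lfunE.
  by rewrite -aA // -comp_lfunE repBA_eq0 zero_lfunE.
have [l1 e1] : exists l1 : 'I_n, l1 = n.-2 :> nat.
  by have l : (n.-2 < n)%N by [lia]; exists (Ordinal l).
have [l2 e2] : exists l2 : 'I_n, l2 = n.-1 :> nat.
  by have l : (n.-1 < n)%N by [lia]; exists (Ordinal l).
(* Recursion from the leaves towards the root. At the branching vertex only [l1] counts, since the
   term of [l2] will turn out to be the opposite one. *)
have [b bE] : exists b : forall i, V i, forall i,
    b i = \sum_j Ymap r i j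
      (if j == l1 then a j else if j == l2 then 0 else b j).
  apply: (@dependent_fixpoint _ V (fun=> 0) _ (fun i => n - val i)%N).
  move=> x y i xy.
  apply: eq_bigr => j _.
  have [ij|/Ymap0->] := boolP (D_adj i j); last by rewrite !zero_lfunE.
  by rewrite xy //=; have := D_adj_lt n4 ij; have := ltn_ord j; lia.
have b_leaf (i : 'I_n) : leaf i -> b i = 0.
  move=> li; rewrite bE big1 // => j _.
  by rewrite Ymap0 ?zero_lfunE // leaf_D_adj.
have neq_l (j l : 'I_n) : ~~ leaf j -> leaf l -> (j == l) = false.
  by move=> lj ll; apply: contraNF lj => /eqP->.
have L1 : leaf l1 by rewrite /leaf; lia.
have L2 : leaf l2 by rewrite /leaf; lia.
have Yb (i j : 'I_n) : D_adj i j -> ~~ leaf j -> Ymap r i j (b j) = b i.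
  by move=> ij lj; rewrite [RHS]bE (sum_child _ ij lj) !neq_l.
have b_branch (i : 'I_n) : D_adj i l1 -> Ymap r i l1 (a l1) = b i.
  move=> il; rewrite [RHS]bE (sum_legs _ il e1 e2) !eqxx.
  have -> : (l2 == l1) = false by apply/eqP => /(congr1 val) /=; lia.
  by rewrite linear0 addr0.
(* Induction from the root: the moment map at [i], applied to [a i], equates $Y a_j$ with the image
   under $X$ of $Y a_i$, which vanishes by induction. *)
have Ya0 (i j : 'I_n) : D_adj i j -> ~~ leaf j -> Ymap r i j (a j) = 0.
  move: {2}(val j).+1 (ltnSn (val j)) => m.
  elim: m i j => // m IH i j jm ij lj.
  have := moment_at (a i); rewrite Ba linear0 addr0.
  rewrite (@sum_child i j (fun j => Xmap r i j (a i))) // Xa //.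
  move/eqP; rewrite subr_eq0 => /eqP <-; apply: big1 => k _.
  have [ki|/Xmap0->] := boolP (D_adj k i); last by rewrite zero_lfunE.
  rewrite IH ?linear0 //.
    by apply: leq_trans (D_adj_lt n4 ij) _.
  by apply: contraTN ij; apply: leaf_D_adj.
(* At the branching vertex the incoming term vanishes by [Ya0], so the two leg terms add up to
   zero. *)
have b_branch2 (i : 'I_n) : D_adj i l2 -> Ymap r i l2 (a l2) = - b i.
  move=> il2; have il1 : D_adj i l1 by rewrite (D_adj_leafP n4 l1 il2 L2).
  have := moment_at (a i); rewrite Ba linear0 addr0.
  rewrite (@sum_legs i l1 l2 (fun j => Xmap r i j (a i))) // !Xa // b_branch //.
  rewrite big1 ?sub0r.
    by move/eqP; rewrite oppr_eq0 addrC addr_eq0 => /eqP.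
  move=> k _; have [ki|/Xmap0->] := boolP (D_adj k i).
    rewrite Ya0 ?linear0 //.
    by apply: contraTN il1; apply: leaf_D_adj.
  by rewrite zero_lfunE.
(* A leaf meets a single arrow and has no framing, so its moment map equation is just $XY = 0$. *)
have XY_leaf (i l : 'I_n) v : D_adj i l -> leaf l ->
    Xmap r i l (Ymap r i l v) = 0.
  move=> il ll; have := moment_at v.
  rewrite (@sum_parent l i (fun k => Ymap r k l v)) // big1 => [|j _].
    rewrite subr0 repB_eq0 ?zero_lfunE ?linear0 ?addr0 //.
    by apply: leq_ltn_trans (D_adj_lt n4 il).
  by rewrite Ymap0 ?zero_lfunE // leaf_D_adj.
(* Induction from the leaves. Towards a leaf, $b_i$ is plus or minus $Y a$ and [XY_leaf] applies;
   otherwise $b_i = Y b_j$, and the moment map at [j] trades $XY b_j$ for $YX b_j$. *)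
have Xb (i j : 'I_n) : Xmap r i j (b i) = 0.
  have [ij|/Xmap0->] := boolP (D_adj i j); last by rewrite zero_lfunE.
  move: {2}(n - j)%N (leqnn (n - j)) => m.
  elim: m i j ij => [|m IH] i j ij jm.
    by have := ltn_ord j; lia.
  have [lj|lj] := boolP (leaf j).
    have il1 : D_adj i l1 by rewrite (D_adj_leafP n4 l1 ij lj).
    have il2 : D_adj i l2 by rewrite (D_adj_leafP n4 l2 ij lj).
    have [ej|ej] := leafP n4 lj.
      have -> : j = l1 by apply/val_inj; rewrite /= ej.
      by rewrite -b_branch // XY_leaf.
    have -> : j = l2 by apply/val_inj; rewrite /= ej.
    by rewrite -[b i]opprK -b_branch2 // linearN /= XY_leaf // oppr0.
  rewrite -(Yb i j) //.
  have := moment_at (b j).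
  rewrite (@sum_parent j i (fun k => Ymap r k j (b j))) //.
  rewrite repB_eq0 ?zero_lfunE ?linear0 ?addr0; last first.
    by apply: leq_ltn_trans (D_adj_lt n4 ij).
  rewrite [X in _ - X]big1 ?subr0 // => k _.
  have [jk|/Ymap0->] := boolP (D_adj j k); last by rewrite zero_lfunE.
  by rewrite IH ?linear0 //; have := D_adj_lt n4 jk; have := ltn_ord k; lia.
have Ya (i j : 'I_n) : D_adj i j -> Ymap r i j (a j) = leg_sign j *: b i.
  move=> ij; rewrite /leg_sign; case: eqP => [j1|j1].
    have e : j = l1 by apply/val_inj; rewrite /= j1.
    by rewrite e b_branch ?scale1r // -e.
  case: eqP => [j2|j2].
    have e : j = l2 by apply/val_inj; rewrite /= j2.
    by rewrite e b_branch2 ?scaleN1r // -e.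
  by rewrite scale0r Ya0 //; apply/negP => /leafP[].
(* Stability applied to the spans themselves, which the relations above make invariant. *)
have span (i : 'I_n) : (<[a i]> + <[b i]>)%VS = fullv.
  move: i; move/stableE: sr; apply => [i|i j|i j].
  - apply/subvP => _ /memv_imgP[w _ ->].
    have [i0|i0] := posnP i; last by rewrite (framing_eq0 w i0) linear0 mem0v.
    have [c ->] := framing_span w.
    by rewrite linearZ /= aA // memvZ // (subvP (addvSl _ _)) ?memv_line.
  - have [ij|/Xmap0->] := boolP (D_adj i j); last by rewrite lim0g sub0v.
    by rewrite limgD !limg_line Xa // Xb addvS // -memvE mem0v.
  - have [ij|/Ymap0->] := boolP (D_adj i j); last by rewrite lim0g sub0v.
    rewrite limgD !limg_line Ya //.
    have bi : b i \in (<[a i]> + <[b i]>)%VS.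
      by rewrite (subvP (addvSr _ _)) ?memv_line.
    rewrite subv_add -!memvE memvZ //=.
    have [lj|lj] := boolP (leaf j); first by rewrite b_leaf // linear0 mem0v.
    by rewrite Yb.
(* At vertex 0 the moment map on [b i] reduces to $A B b_0 = c\,a_0 = 0$. If $a_0 = 0$, then all the
   $a_j$ vanish, and with them all the $b_j$. *)
have Bb (i : 'I_n) : repB r i (b i) = 0.
  have [i0|i0] := posnP i; last by rewrite repB_eq0 // zero_lfunE.
  have [c Ec] := framing_span (repB r i (b i)).
  have := moment_at (b i).
  rewrite big1 => [|j _]; last by rewrite Xmap0 ?zero_lfunE // parent_of_root.
  rewrite big1 => [|j _]; last by rewrite Xb linear0.
  rewrite subr0 add0r Ec linearZ /= aA // => /eqP.
  rewrite scaler_eq0 => /orP[/eqP c0|/eqP ai0].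
    by rewrite c0 scale0r.
  have a0 (j : 'I_n) : a j = 0.
    move: {2}(val j).+1 (ltnSn (val j)) => m.
    elim: m j => // m IH j jm; have [j0|j0] := posnP j.
      by have -> : j = i by apply/val_inj; rewrite /= j0 i0.
    have [k kj] := has_parent n4 j0.
    by rewrite -(Xa k) // IH ?linear0 // (leq_trans (D_adj_lt n4 kj)).
  have b0 (j : 'I_n) : b j = 0.
    move: {2}(n - j)%N (leqnn (n - j)) => m.
    elim: m j => [|m IH] j jm; first by have := ltn_ord j; lia.
    rewrite bE big1 // => k _.
    have [jk|/Ymap0->] := boolP (D_adj j k); last by rewrite zero_lfunE.
    case: eqP => _; first by rewrite a0 linear0.
    case: eqP => _; rewrite ?linear0 // IH ?linear0 //.
    by have := D_adj_lt n4 jk; have := ltn_ord k; lia.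
  by rewrite -Ec b0 linear0.
exists a, b; split=> // i; apply/lfunP => v; rewrite zero_lfunE.
have : v \in (<[a i]> + <[b i]>)%VS by rewrite span memvf.
case/memv_addP => _ /vlineP[x ->] [_ /vlineP[y ->] ->].
by rewrite linearD !linearZ /= Ba Bb !scaler0 addr0.
Qed.

End Moment.

End Frames.

(* The order ideal conditions read off the dimensions: d_(i,1) is present when
   [0 < v i] and d_(i,2) when [1 < v i]. *)
Definition good_dim n (v : 'I_n -> nat) : Prop :=
  [/\ forall i j, D_adj i j -> (0 < v j)%N -> (0 < v i)%N,
      forall i j, D_adj i j -> (1 < v i)%N -> (~~ leaf j < v j)%N &
      forall j, (v j <= (~~ leaf j).+1)%N].

(** * Consequences of having a frame *)

Section FrameTheory.
Variables (F : fieldType) (n : nat) (V : 'I_n -> vectType F).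
Hypothesis n4 : (4 <= n)%N.
Notation W := (coord_space F (delta1 n)).
Notation rep := (@framed_rep F (D_quiver n) V W).

Lemma leg_sign_nonleaf (j : 'I_n) : ~~ leaf j -> leg_sign F j = 0.
Proof.
by rewrite /leaf /leg_sign => lj; do 2 (case: eqP => [?|_]; first by lia).
Qed.

Lemma leg_sign_neq0 (j : 'I_n) : leaf j -> leg_sign F j != 0.
Proof.
case/(leafP n4) => e; rewrite /leg_sign e eqxx /= ?oner_eq0 //.
by case: (n.-1 =P n.-2) => _; rewrite ?oppr_eq0 oner_eq0.
Qed.

Section OneFrame.
Variables (r : rep) (a b : forall i, V i).
Hypothesis fr : frame r a b.

Lemma frame_eq (U : vectType F) (i : 'I_n) (f g : 'Hom(V i, U)) :
  f (a i) = g (a i) -> f (b i) = g (b i) -> f = g.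
Proof.
move=> fga fgb; apply/lfunP => w.
have : w \in (<[a i]> + <[b i]>)%VS by rewrite (frame_span fr) memvf.
case/memv_addP => _ /vlineP[x ->] [_ /vlineP[y ->] ->].
by rewrite !linearD !linearZ /= fga fgb.
Qed.

Lemma frame_YXa (i j : 'I_n) : Ymap r i j (Xmap r i j (a i)) =
  if D_adj i j then leg_sign F j *: b i else 0.
Proof.
case: ifP => ij; first by rewrite (frame_Xa fr) // (frame_Ya fr).
by rewrite Xmap0 ?ij // zero_lfunE linear0.
Qed.

(** As $X b = 0$, the only terms that may survive are the $YX a_i$ at the branching vertex, where
    the two leg signs cancel. *)
Lemma frame_moment i : moment_map r i = 0.
Proof.
rewrite moment_mapE (frame_B fr) comp_lfun0r addr0 big1 => [|j _].
  rewrite sub0r; apply/eqP; rewrite oppr_eq0; apply/eqP.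
  apply: frame_eq; rewrite sum_lfunE zero_lfunE; last first.
    by apply: big1 => j _; rewrite comp_lfunE (frame_Xb fr) linear0.
  under eq_bigr => j _ do rewrite comp_lfunE frame_YXa.
  rewrite -big_mkcond /=.
  have [li|/(has_child n4)[j ij [ej|lj]]] := boolP (leaf i).
  - by rewrite big1 // => j ij; have := leaf_D_adj n4 j li; rewrite ij.
  - have lj : leaf j by rewrite /leaf ej; lia.
    have ln : (n.-1 < n)%N by lia.
    rewrite (bigD1 j) //= (bigD1 (Ordinal ln)) /=; last first.
      rewrite (D_adj_leafP n4 _ ij lj) /leaf /=.
      by apply/andP; split; [lia | apply/eqP => /(congr1 val) /=; lia].
    rewrite big1 => [|k /andP[/andP[ik kj] kl]].
      rewrite /leg_sign ej eqxx /= eqxx.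
      by case: eqP => [|_]; [lia | rewrite scaleN1r scale1r addr0 subrr].
    move: ik; rewrite (D_adj_leafP n4 _ ij lj) => /(leafP n4)[] e.
      by case/eqP: kj; apply/val_inj; rewrite /= e ej.
    by case/eqP: kl; apply/val_inj.
  - apply: big1 => k /(D_adj_child n4 ij lj) ->.
    by rewrite leg_sign_nonleaf // scale0r.
have [ji|ji] := boolP (D_adj j i); last by rewrite Xmap0 // comp_lfun0l.
apply: frame_eq; rewrite comp_lfunE zero_lfunE.
  by rewrite (frame_Ya fr) // linearZ /= (frame_Xb fr) scaler0.
have [li|li] := boolP (leaf i); first by rewrite (frame_leaf fr) // !linear0.
by rewrite (frame_Yb fr) // (frame_Xb fr).
Qed.

(** An invariant family picks up every [a i] going out from the root along $X$, then every [b i]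
    coming back along $Y$. *)
Lemma frame_stable : stable r.
Proof.
apply/stableE => S SA SX SY.
have Sa i : a i \in S i.
  move: {2}(val i).+1 (ltnSn (val i)) => m.
  elim: m i => // m IH j jm; have [j0|j0] := posnP j.
    by rewrite -(frame_A fr j0) (subvP (SA j)) // memv_img ?memvf.
  have [i ij] := has_parent n4 j0.
  rewrite -(frame_Xa fr ij) (subvP (SX i j)) // memv_img // IH //.
  by rewrite (leq_trans (D_adj_lt n4 ij)).
have Sb i : b i \in S i.
  move: {2}(n - i)%N (leqnn (n - i)) => m.
  elim: m i => [|m IH] i im; first by have := ltn_ord i; lia.
  have [li|/(has_child n4)[j ij [ej|lj]]] := boolP (leaf i).
  - by rewrite (frame_leaf fr) // mem0v.
  - have -> : b i = Ymap r i j (a j).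
      by rewrite (frame_Ya fr) // /leg_sign ej eqxx scale1r.
    by rewrite (subvP (SY i j)) // memv_img.
  - rewrite -(frame_Yb fr ij lj) (subvP (SY i j)) // memv_img // IH //.
    by have := D_adj_lt n4 ij; have := ltn_ord j; lia.
move=> i; apply/eqP; rewrite eqEsubv subvf -(frame_span fr i) subv_add.
by rewrite -!memvE Sa Sb.
Qed.

(** The vanishing of [a j] travels along $X$ to a leaf, passes to $b$ through the nonzero leg sign,
    and returns along $Y$. *)
Lemma frame_b_eq0 (i j : 'I_n) : D_adj i j -> a j = 0 -> b i = 0.
Proof.
move: {2}(n - j)%N (leqnn (n - j)) => m.
elim: m i j => [|m IH] i j jm ij aj; first by have := ltn_ord j; lia.
have [lj|lj] := boolP (leaf j).
  have := frame_Ya fr ij; rewrite aj linear0 => /esym/eqP.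
  by rewrite scaler_eq0 (negPf (leg_sign_neq0 lj)) => /eqP.
have [k jk _] := has_child n4 lj.
rewrite -(frame_Yb fr ij lj) (IH j k) ?linear0 //.
  by have := D_adj_lt n4 jk; have := ltn_ord k; lia.
by rewrite -(frame_Xa fr jk) aj linear0.
Qed.

(** If $a_i$ were a multiple of $b_i$, applying $X$ would give $a_j = 0$ at a child, hence $b_i = 0$
    by [frame_b_eq0]. *)
Lemma frame_indep (i : 'I_n) : b i != 0 -> a i \notin <[b i]>%VS.
Proof.
apply: contraNN => /vlineP[x ax].
have [li|/(has_child n4)[j ij _]] := boolP (leaf i).
  by rewrite (frame_leaf fr).
rewrite (frame_b_eq0 ij) // -(frame_Xa fr ij) ax linearZ /= (frame_Xb fr).
exact: scaler0.
Qed.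

Lemma frame_dim (i : 'I_n) : dim (V i) = ((a i != 0)%R + (b i != 0)%R)%N.
Proof.
rewrite -dimvf -(frame_span fr i) dimv_disjoint_sum ?dim_vline //.
apply/eqP; rewrite -subv0; apply/subvP => w /memv_capP[/vlineP[x ->] xb].
have [bi|/frame_indep/negP ai] := eqVneq (b i) 0%R.
  by move: xb; rewrite bi.
have [->|x0] := eqVneq x 0%R; first by rewrite scale0r mem0v.
by case: ai; rewrite -(scalerK x0 (a i)) memvZ.
Qed.

Lemma frame_a_neq0 (i : 'I_n) : b i != 0 -> a i != 0.
Proof. by move=> /frame_indep; apply: contraNneq => ->; rewrite mem0v. Qed.

Lemma frame_dim_gt0 (i : 'I_n) : (0 < dim (V i))%N = (a i != 0).
Proof.
rewrite frame_dim; have := @frame_a_neq0 i.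
by case: (a i != 0); case: (b i != 0) => //= /(_ isT).
Qed.

Lemma frame_dim_gt1 (i : 'I_n) : (1 < dim (V i))%N = (b i != 0).
Proof.
rewrite frame_dim; have := @frame_a_neq0 i.
by case: (a i != 0); case: (b i != 0) => //= /(_ isT).
Qed.

Lemma frame_good_dim : good_dim (fun i => dim (V i)).
Proof.
split=> [i j ij|i j ij|j].
- rewrite !frame_dim_gt0; apply: contraNneq => ai.
  by rewrite -(frame_Xa fr ij) ai linear0.
- rewrite frame_dim_gt1; have [lj|lj] := boolP (leaf j).
    by rewrite frame_dim_gt0; apply: contraNneq => /(frame_b_eq0 ij) ->.
  rewrite frame_dim_gt1; apply: contraNneq => bj.
  by rewrite -(frame_Yb fr ij lj) bj linear0.
- rewrite frame_dim; have [lj|_] := boolP (leaf j).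
    by rewrite (frame_leaf fr) // eqxx addn0 leq_b1.
  by case: (_ != 0); case: (_ != 0).
Qed.

End OneFrame.

(** The structure constants are the same in every frame, so a base change matching the spanning
    vectors intertwines all the maps. *)
Lemma frame_GL_act (r r' : rep) a a' b b' (g : forall i, 'End(V i)) :
  frame r a b -> frame r' a' b' -> @in_GL F (D_quiver n) V g ->
  (forall i, g i (a i) = a' i) -> (forall i, g i (b i) = b' i) ->
  r' = @GL_act F (D_quiver n) V W g r.
Proof.
move=> fr fr' GLg ga gb.
have XE : forall e, repX r' e =
    (g (Defs.head e) \o repX r e \o (g (Defs.tail e))^-1)%VF.
  apply: D_arrow_ind => i j H /=; rewrite -!XmapE.
  rewrite -[LHS](lker0_compfK (GLg i)); congr (_ \o _)%VF.
  apply: (frame_eq fr); rewrite !comp_lfunE ?ga ?gb.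
    by rewrite (frame_Xa fr) // (frame_Xa fr').
  by rewrite (frame_Xb fr) (frame_Xb fr') linear0.
have YE : forall e, repY r' e =
    (g (Defs.tail e) \o repY r e \o (g (Defs.head e))^-1)%VF.
  apply: D_arrow_ind => i j H /=; rewrite -!YmapE.
  rewrite -[LHS](lker0_compfK (GLg j)); congr (_ \o _)%VF.
  apply: (frame_eq fr); rewrite !comp_lfunE ?ga ?gb.
    by rewrite (frame_Ya fr) // (frame_Ya fr') // linearZ /= gb.
  have [lj|lj] := boolP (leaf j).
    by rewrite (frame_leaf fr) // (frame_leaf fr') // !linear0.
  by rewrite (frame_Yb fr) // (frame_Yb fr').
have AE : forall i, repA r' i = (g i \o repA r i)%VF.
  move=> i; apply/lfunP => w; rewrite comp_lfunE.
  have [i0|i0] := posnP i; last by rewrite !repA_eq0 // !zero_lfunE linear0.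
  have [c ->] := framing_span w.
  by rewrite !linearZ /= (frame_A fr) // (frame_A fr') // ga.
have BE : forall i, repB r' i = (repB r i \o (g i)^-1)%VF.
  by move=> i; rewrite (frame_B fr) (frame_B fr') comp_lfun0l.
apply: eq_framed_rep; [exact: XE|exact: YE|exact: AE|exact: BE].
Qed.

End FrameTheory.

(** * The standard point and uniqueness of the orbit *)

Section StandardRep.
Variables (F : fieldType) (n : nat) (v : {ffun 'I_n -> nat}).
Hypothesis n4 : (4 <= n)%N.
Notation W := (coord_space F (delta1 n)).
Notation V := (coord_space F v).
Notation rep := (@framed_rep F (D_quiver n) V W).

Definition nat_mx p q (f : nat -> nat -> F) : 'M[F]_(p, q) :=
  \matrix_(k, l) f k l.

(** Indexing by a natural number makes the column 0 when [s] is at least [p], so the vectors absent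
    from a small $V_i$ are zero automatically. *)
Definition basis_col p (s : nat) : 'cV[F]_p := \col_k (k == s :> nat)%:R.

Lemma nat_mx_basis p q f s : nat_mx p q f *m basis_col q s =
  \col_k (if (s < q)%N then f k s else 0).
Proof.
apply/matrixP => k l; rewrite !mxE; case: ifP => sq.
  rewrite (bigD1 (Ordinal sq)) //= big1 ?addr0 => [|j js].
    by rewrite !mxE /= eqxx mulr1.
  by rewrite !mxE; have /negPf-> : j != s :> nat by []; rewrite mulr0.
rewrite big1 // => j _; rewrite !mxE.
by case: eqP => [js|_]; rewrite ?mulr0 //; have := ltn_ord j; rewrite js sq.
Qed.

Definition std_X (i j : 'I_n) : 'Hom(V i, V j) :=
  linfun (mulmx (nat_mx (v j) (v i) (fun k l => ((k == 0) && (l == 0))%N%:R))).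

(** Columns 0 and 1 are [frame_Ya] and [frame_Yb] in coordinates. *)
Definition std_Y (i j : 'I_n) : 'Hom(V j, V i) :=
  linfun (mulmx (nat_mx (v i) (v j) (fun k l => (k == 1)%N%:R *
    (if l == 0 then leg_sign F j else (l == 1)%N%:R)))).

Definition std_A (i : 'I_n) : 'Hom(W i, V i) :=
  linfun (mulmx (nat_mx (v i) (delta1 n i) (fun k _ => (k == 0)%N%:R))).

Definition std_rep : rep :=
  @FramedRep F (D_quiver n) V W (fun e => std_X (Defs.tail e) (Defs.head e))
    (fun e => std_Y (Defs.tail e) (Defs.head e)) std_A (fun=> 0).

Definition std_a (i : 'I_n) : V i := basis_col (v i) 0.
Definition std_b (i : 'I_n) : V i := basis_col (v i) 1.

(** A relation could fail only if its source vector were cut off while its target survives, which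
    [good_dim] excludes. *)
Lemma std_frame : good_dim v -> frame std_rep std_a std_b.
Proof.
case=> g1 g2 g3; split=> //.
- move=> i i0; rewrite /= /std_A lfunE /= /framing.
  have -> : const_mx 1 = basis_col (delta1 n i) 0.
    apply/matrixP => k l; rewrite !mxE; have := ltn_ord k.
    by rewrite {2}ffunE /label i0 ltnS leqn0 => ->.
  by rewrite nat_mx_basis ffunE /label i0.
- move=> i j ij; rewrite (XmapE _ ij) /= /std_X lfunE /= nat_mx_basis.
  apply/matrixP => k l; rewrite !mxE andbT.
  by rewrite (g1 i j) // (leq_ltn_trans _ (ltn_ord k)).
- move=> i j; have [ij|/Xmap0->] := boolP (D_adj i j); last first.
    by rewrite zero_lfunE.
  rewrite (XmapE _ ij) /= /std_X lfunE /= nat_mx_basis.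
  by apply/matrixP => k l; rewrite !mxE andbF if_same.
- move=> i j ij; rewrite (YmapE _ ij) /= /std_Y lfunE /= nat_mx_basis.
  apply/matrixP => k l; rewrite !mxE.
  have [k1|] := eqVneq (k : nat) 1%N; last by rewrite mul0r if_same mulr0.
  have /(g2 _ _ ij) : (1 < v i)%N by rewrite -k1 ltn_ord.
  by move/(leq_ltn_trans (leq0n _)) => ->; rewrite mul1r mulr1.
- move=> i j ij lj; rewrite (YmapE _ ij) /= /std_Y lfunE /= nat_mx_basis.
  apply/matrixP => k l; rewrite !mxE.
  have [k1|] := eqVneq (k : nat) 1%N; last by rewrite mul0r if_same.
  have /(g2 _ _ ij) : (1 < v i)%N by rewrite -k1 ltn_ord.
  by rewrite lj => ->; rewrite mul1r.
- move=> i li; apply/matrixP => k l; rewrite !mxE.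
  have := g3 i; rewrite li => /(leq_trans (ltn_ord k)).
  by rewrite ltnS leqn0 => /eqP->.
- move=> i; apply/eqP; rewrite eqEsubv subvf /=; apply/subvP => w _.
  have -> : w = \sum_k (w : 'cV_(v i)) k 0 *: (basis_col (v i) k : V i).
    apply/matrixP => k l; rewrite ord1 summxE (bigD1 k) //= big1 ?addr0.
      by rewrite !mxE eqxx mulr1.
    move=> j jk; rewrite !mxE.
    by have /negPf-> : k != j :> nat by [rewrite eq_sym]; rewrite mulr0.
  apply: memv_suml => k _; apply: memvZ.
  have : (k <= 1)%N.
    rewrite -ltnS (leq_trans (ltn_ord k)) // (leq_trans (g3 i)) //.
    by rewrite ltnS leq_b1.
  case: (k : nat) => [|[|//]] _.
    by rewrite (subvP (addvSl _ _)) ?memv_line.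
  by rewrite (subvP (addvSr _ _)) ?memv_line.
Qed.

Lemma frame_orbit (r : rep) a b : frame r a b ->
  good_dim v /\ GL_orbit r = GL_orbit std_rep.
Proof.
move=> fr.
have dimV (i : 'I_n) : dim (V i) = v i by rewrite dim_matrix mulr1.
have good : good_dim v.
  have := frame_good_dim n4 fr.
  by rewrite (_ : (fun i => _) = v) //; apply/funext => i; exact: dimV.
split=> //.
(* The columns are [a i] and [b i]; there are at most two of them because [good] bounds [v i]. *)
pose g (i : 'I_n) : 'End(V i) := linfun (mulmx (\matrix_(k, l)
  (if l == 0%N :> nat then (a i : 'cV_(v i)) k 0 else (b i : 'cV_(v i)) k 0))).
have mulmx_basis p (M : 'M[F]_p) s (sp : (s < p)%N) :
    M *m basis_col p s = col (Ordinal sp) M.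
  rewrite colE; congr (_ *m _); apply/matrixP => k l.
  by rewrite !mxE ord1 eqxx andbT.
have ga i : g i (std_a i) = a i.
  have [v0|v0] := posnP (v i).
    have a0 (x : V i) : x = 0.
      by move: x; rewrite /coord_space v0 => x; apply/matrixP => -[].
    exact: etrans (a0 _) (esym (a0 _)).
  rewrite lfunE /= mulmx_basis; apply/matrixP => k l.
  by rewrite !mxE ord1.
(* If [v i] is at most 1, both vectors are zero. *)
have gb i : g i (std_b i) = b i.
  have := frame_dim_gt1 n4 fr i; rewrite dimV; case: ltnP => v1 /esym bi.
    rewrite lfunE /= mulmx_basis; apply/matrixP => k l.
    by rewrite !mxE ord1.
  have -> : b i = 0 by apply/eqP; rewrite -[_ == _]negbK bi.
  suff -> : std_b i = 0 by rewrite linear0.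
  apply/matrixP => k l; rewrite !mxE.
  by have := leq_trans (ltn_ord k) v1; rewrite ltnS leqn0 => /eqP->.
(* The image contains a spanning pair, so [g i] is onto and, by dimension count, injective. *)
have g0 : @in_GL F (D_quiver n) V g.
  move=> i; have limg_g : limg (g i) = fullv.
    apply/eqP; rewrite eqEsubv subvf.
    rewrite -[X in (X <= _)%VS](frame_span fr i) subv_add -!memvE.
    by rewrite /=; apply/andP; split; [rewrite -ga|rewrite -gb];
      apply: memv_img; apply: memvf.
  have := limg_ker_dim (g i) fullv; rewrite limg_g capfv => /eqP.
  by rewrite -[X in _ == X]add0n eqn_add2r dimv_eq0.
by rewrite (frame_GL_act (std_frame good) fr g0 ga gb) GL_orbit_act.
Qed.

Lemma quiver_varietyE : good_dim v ->
  nakajima_variety F (D_quiver n) v (delta1 n) = [set GL_orbit std_rep].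
Proof.
move=> good; apply/seteqP; split=> [_ [r [mr sr] <-]|_ ->].
  have [a [b fr]] := frame_exists n4 mr sr.
  by have [_ ->] := frame_orbit fr.
exists std_rep => //; split=> [i|].
  exact: (frame_moment n4 (std_frame good)).
exact: (frame_stable n4 (std_frame good)).
Qed.

Lemma nakajima_variety_nonempty :
  nakajima_variety F (D_quiver n) v (delta1 n) !=set0 <-> good_dim v.
Proof.
split=> [[_ [r [mr sr] _]]|good]; last first.
  by rewrite quiver_varietyE //; eexists.
have [a [b fr]] := frame_exists n4 mr sr.
by have [] := frame_orbit fr.
Qed.

End StandardRep.

(** * Order ideals and their color counts *)

Section Ideals.
Variable n : nat.
Hypothesis n4 : (4 <= n)%N.
Implicit Types (P : {set D_fund n}) (i j : 'I_n) (s : bool).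

Lemma ideal_gen P : is_D_poset P <->
  forall x y, fund_gen x y -> y \in P -> x \in P.
Proof.
split=> [idP x y xy|genP x y].
  by apply: idP; apply: connect1.
case/connectP => p; elim: p x => [|z p IHp] x /= => [_ -> //|].
by case/andP => xz zp yE yP; apply: genP xz _; apply: IHp.
Qed.

(** Total in [(i, s)], which avoids the side condition of [D_fund]: the second slot of a leaf is
    simply empty. *)
Definition slot P i s := [exists x in P, fund_val x == (i, s)].

Lemma slotE P x : slot P (color x) (second x) = (x \in P).
Proof.
apply/exists_inP/idP => [[y yP /eqP yx]|xP].
  have -> // : x = y; by apply: val_inj; rewrite /= yx -surjective_pairing.
by exists x; rewrite -?surjective_pairing.
Qed.

(** Elements of one color are told apart by [second]. *)
Lemma color_countE P i : color_count P i = (slot P i false + slot P i true)%N.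
Proof.
rewrite ffunE -(@card_in_imset _ _ (@second n)) => [|x y]; last first.
  rewrite !inE => /andP[_ /eqP xi] /andP[_ /eqP yi] sxy.
  apply: val_inj; rewrite /= [LHS]surjective_pairing [RHS]surjective_pairing.
  by congr pair => //; rewrite -/(color x) -/(color y) xi yi.
rewrite (_ : imset _ _ = [set s | slot P i s]%SET); last first.
  apply/setP => s; rewrite inE; apply/imsetP/exists_inP => [[x]|[x xP /eqP xE]].
    rewrite inE => /andP[xP /eqP <-] ->; exists x => //.
    by rewrite -surjective_pairing.
  by exists x; rewrite ?inE ?xP /color /second /= xE ?eqxx.
rewrite cardsE -sum1_card big_mkcond big_bool /= addnC.
rewrite !unfold_in -!/(slot _ _ _).
by case: (slot P i false); case: (slot P i true).
Qed.

Lemma D_fund_exists i s : s ==> ~~ leaf i ->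
  exists x : D_fund n, fund_val x = (i, s).
Proof.
move=> h; have hx : (i, s).2 ==> (label (i, s).1 <= n - 2)%N.
  by rewrite /label; case: s h => //=; rewrite /leaf; lia.
by exists (DFund hx).
Qed.

Lemma slot_leaf P i : leaf i -> slot P i true = false.
Proof.
rewrite /leaf => li; apply/exists_inP => -[[x hx] _ /eqP /= xE].
by move: hx; rewrite xE /= /label; lia.
Qed.

Section IdealSlots.
Variable P : {set D_fund n}.
Hypothesis idP : is_D_poset P.

Lemma slot_gen x y : fund_gen x y -> slot P (color y) (second y) ->
  slot P (color x) (second x).
Proof. by rewrite !slotE; move/ideal_gen: idP; apply. Qed.

Lemma slot_first i j : D_adj i j -> slot P j false -> slot P i false.
Proof.
move=> ij; have [x xE] := @D_fund_exists i false isT.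
have [y yE] := @D_fund_exists j false isT.
have := @slot_gen x y; rewrite /fund_gen /color /second /= xE yE /=.
by apply.
Qed.

(** Below $d_{i,2}$ lies $d_{j,2}$ for an inner child and $d_{j,1}$ for a leaf; the index
    [~~ leaf j] selects the right one. *)
Lemma slot_second i j : D_adj i j -> slot P i true -> slot P j (~~ leaf j).
Proof.
move=> ij; have li : ~~ leaf i by apply: contraTN ij; apply: leaf_D_adj.
have [x xE] := @D_fund_exists j (~~ leaf j) (implybb _).
have [y yE] := @D_fund_exists i true li.
have := @slot_gen x y; rewrite /fund_gen /color /second /= xE yE /=; apply.
move: ij li; rewrite D_adjE // /leaf /label; have := ltn_ord j.
by case: (leqP (n - 2) j) => /=; lia.
Qed.

(** From $d_{i,2}$ the order descends through second elements to a leaf, then through first elements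
    back to $d_{i,1}$. *)
Lemma slot_second_first i : slot P i true -> slot P i false.
Proof.
move: {2}(n - i)%N (leqnn (n - i)) => m.
elim: m i => [|m IH] i im; first by have := ltn_ord i; lia.
move=> si; have li : ~~ leaf i by apply: contraTN si => li; rewrite slot_leaf.
have [j ij _] := has_child n4 li.
apply: (slot_first ij); have := slot_second ij si.
have [//|lj] := boolP (leaf j).
by apply: IH; have := D_adj_lt n4 ij; have := ltn_ord j; lia.
Qed.

Lemma color_count_slot i s : (s < color_count P i)%N = slot P i s.
Proof.
rewrite color_countE; have := @slot_second_first i.
by case: s; case: (slot P i true); case: (slot P i false) => //= /(_ isT).
Qed.

(** An ideal is thus recovered from its color count, which gives injectivity. *)
Lemma ideal_mem x : (x \in P) = (second x < color_count P (color x))%N.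
Proof. by rewrite color_count_slot slotE. Qed.

Lemma ideal_good_dim : good_dim (color_count P).
Proof.
have c0 i : (0 < color_count P i)%N = slot P i false.
  by rewrite -color_count_slot.
have c1 i : (1 < color_count P i)%N = slot P i true.
  by rewrite -color_count_slot.
split=> [i j ij|i j ij|j].
- by rewrite !c0; apply: slot_first ij.
- by rewrite c1 color_count_slot; apply: slot_second ij.
- rewrite color_countE; have [lj|_] := boolP (leaf j).
    by rewrite slot_leaf // addn0 leq_b1.
  by do 2 case: slot.
Qed.

End IdealSlots.

(** The inverse map: the criterion of [ideal_mem] serves as the definition of the ideal. *)
Lemma good_dim_ideal (v : {ffun 'I_n -> nat}) : good_dim v ->
  exists2 P, is_D_poset P & color_count P = v.
Proof.
case=> g1 g2 g3; pose P := [set x : D_fund n | (second x < v (color x))%N]%SET.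
exists P.
  apply/ideal_gen => x y; rewrite !inE /fund_gen.
  case sx: (second x); case sy: (second y) => // xy.
  (* Below a second element the order runs against the arrows, hence the swapped arguments. *)
  - have yx : D_adj (color y) (color x) by move: xy; rewrite /D_adj; lia.
    move/(g2 _ _ yx); rewrite /leaf.
    by have -> : ~~ (n - 2 <= color x)%N by move: xy; rewrite /label; lia.
  - have yx : D_adj (color y) (color x) by move: xy; rewrite /D_adj; lia.
    by move/(g2 _ _ yx); apply: leq_ltn_trans.
  - exact: g1.
have slotP i s : s ==> ~~ leaf i -> slot P i s = (s < v i)%N.
  move=> /D_fund_exists[x xE].
  by have := slotE P x; rewrite inE /color /second /= xE.
apply/ffunP => i; rewrite color_countE slotP //; have := g3 i.
have [li|li] := boolP (leaf i).
  by rewrite slot_leaf //; case: (v i) => [|[]].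
by rewrite slotP //; case: (v i) => [|[|[]]].
Qed.

End Ideals.

Theorem theorem4p12 (R : realType) (n : nat) (hn : (4 <= n)%N) :
  (forall v : {ffun 'I_n -> nat},
     nakajima_variety R[i] (D_quiver n) v (delta1 n) !=set0 ->
     nakajima_dim R[i] (D_quiver n) v (delta1 n) 0%N) /\
  set_bij
    [set P : {set D_fund n} | is_D_poset P]
    [set v : {ffun 'I_n -> nat} |
       nakajima_variety R[i] (D_quiver n) v (delta1 n) !=set0]
    (@color_count n).
Proof.
split=> [v /(nakajima_variety_nonempty _ v hn) good|].
  exact: variety_dim_point (quiver_varietyE _ hn good).
split=> [P idP|P P' /set_mem idP /set_mem idP' cc|v].
- by apply/(nakajima_variety_nonempty _ _ hn)/ideal_good_dim.
- by apply/setP => x; rewrite !ideal_mem // cc.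
- move=> /(nakajima_variety_nonempty _ v hn)/(good_dim_ideal hn)[P idP <-].
  by exists P.
Qed.
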